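(* Let $\rho_0:=(33-5\sqrt{41})/16$. For each $n$ and $r$ let $\mathbf X_{r,n}$ be a random matrix of size $n\times r$. Assume that for all $0<\bar\rho<2\rho_0$, the largest singular value $\sigma_1$ and the smallest singular value $\sigma_r$ of $\mathbf X_{r,n}$, where $r:=\lfloor\bar\rho n\rfloor$, satisfy for all $n\ge n_0(\bar\rho)$ $$\forall\,0<t<\sqrt{2\rho_0},\quad \mathbb P\Big\{\big(\sigma_1-(1+\sqrt{\bar\rho})\big)\vee\big((1-\sqrt{\bar\rho})-\sigma_r\big)\ge t\Big\}\le c(\bar\rho)\,e^{-n\mathbb W(\bar\rho,t)},$$ where $n_0(\bar\rho)\ge2$ and $c(\bar\rho)>0$ may both depend on $\bar\rho$, and the function $t\mapsto\mathbb W(\bar\rho,t)$ is continuous and (strictly) increasing on $[0,\sqrt{2\rho_0})$ with $\mathbb W(\bar\rho,0)=0$. (1) Let $0<\delta<1$ and $0<\rho<\rho_0$ be such that $$\delta>\frac1{2\rho}\exp\Big\{1-\frac1{2\rho}\,\mathbb W\big[2\rho,\sqrt{2\rho_0}-\sqrt{2\rho}\big]\Big\}.$$ Then for any sequence $(\mathbf M^{(n)})_{n\ge2}$ of random $n\times p$ matrices ($p=p(n)$) with $n/p\to\delta$ satisfying the singular value model (defined in the context) with the family $(\mathbf X_{r,n})$, there is $D_1(\delta,\rho)>0$ (which may depend on $\delta$ and $\rho$) such that for all sufficiently large $n$ $$\mathbb P\Big\{\text{for all integers }1\le s\le s_0=\lfloor\rho n\rfloor:\ \frac{1+\mathfrak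 c_{\max}(2s,\mathbf M^{(n)})}{1-\mathfrak c_{\min}(2s,\mathbf M^{(n)})}<\frac{(4+\sqrt{41})^2}{25}\Big\}\ \ge\ 1-2c(2\rho)e^{-nD_1(\delta,\rho)},$$ and hence this probability tends to $1$. (2) Furthermore, for all $\varepsilon>0$ and for all $0<\bar\rho<2\rho_0$ and $0<\delta<1$ such that $\delta^{-1}\mathbf H_e(\bar\rho\delta)$ belongs to the range of $\mathbb W(\bar\rho,\cdot)$, and for any such sequence $(\mathbf M^{(n)})$ (singular value model, $n/p\to\delta$), there is $D_2(\bar\rho,\delta,\varepsilon)>0$ such that for all sufficiently large $n$ $$\mathbb P\Big\{\mathfrak c_{\min}(\lfloor\bar\rho n\rfloor,\mathbf M^{(n)})\ge\min\{1,(\sqrt{\bar\rho}+t_0)(2-\sqrt{\bar\rho}-t_0)\}+\varepsilon\Big\}\le c(\bar\rho)e^{-nD_2(\bar\rho,\delta,\varepsilon)},$$ $$\mathbb P\Big\{\mathfrak c_{\max}(\lfloor\bar\rho n\rfloor,\mathbf M^{(n)})\ge(\sqrt{\bar\rho}+t_0)(2+\sqrt{\bar\rho}+t_0)+\varepsilon\Big\}\le c(\bar\rho)e^{-nD_2(\bar\rho,\delta,\varepsilon)},$$ where $t_0:=\mathbb W^{-1}\big(\bar\rho,\delta^{-1}\mathbf H_e(\bar\rho\delta)\big)$.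
   Context: $\mathbf H_e(t):=-t\log t-(1-t)\log(1-t)$ for $t\in(0,1)$ (natural logarithm). $\mathbb W^{-1}(\bar\rho,\cdot)$ denotes the inverse of $t\mapsto\mathbb W(\bar\rho,t)$ on its range. $a\vee b=\max(a,b)$. Singular value model: for $R\subseteq\{1,\dots,p\}$, $\mathbf M_R$ is the $n\times|R|$ matrix formed by the columns of $\mathbf M$ indexed by $R$. A random $n\times p$ matrix $\mathbf M$ satisfies the singular value model if for every $r\in\{1,\dots,\lceil2\rho_0n\rceil\}$ and every $R\subseteq\{1,\dots,p\}$ with $|R|=r$, the matrix $\mathbf M_R$ has the same law as $\mathbf X_{r,n}$. (No independence of entries or columns is assumed.) Restricted isometry constants: with $\Sigma_s\subset\mathbb R^p$ the set of vectors with at most $s$ nonzero coordinates, $\mathfrak c_{\min}(s,\mathbf M)$ is the smallest $c_-\ge0$ such that $(1-c_-)\|x\|_2^2\le\|\mathbf Mx\|_2^2$ for all $x\in\Sigma_s$, and $\mathfrak c_{\max}(s,\mathbf M)$ is the smallest $c_+\ge0$ such that $(1+c_+)\|x\|_2^2\ge\|\mathbf Mx\|_2^2$ for all $x\in\Sigma_s$. The ratio $(1+\mathfrak c_{\max})/(1-\mathfrak c_{\min})$ is understood to be $+\infty$ when $\mathfrak c_{\min}=1$. *)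

(* Defs.v *)
From HB Require Import structures.
From mathcomp Require Import all_boot all_order all_algebra.
From mathcomp Require Import all_classical all_reals all_analysis.

Set Implicit Arguments.
Unset Strict Implicit.
Unset Printing Implicit Defensive.
Import Order.TTheory GRing.Theory Num.Theory.
Import numFieldNormedType.Exports.
Local Open Scope classical_set_scope.
Local Open Scope ring_scope.

Definition rho0 (R : realType) : R := (33 - 5 * Num.sqrt 41) / 16.

Definition He (R : realType) (t : R) : R :=
  - t * ln t - (1 - t) * ln (1 - t).

(* The sigma-algebra on matrices generated by the entries (which is also the
   Borel sigma-algebra). *)
Definition mx_measurable (R : realType) (n r : nat) : set (set 'M[R]_(n, r)) :=
  <<s [set E | exists (i : 'I_n) (j : 'I_r) (B : set R),
         measurable B /\ E = (fun A : 'M[R]_(n, r) => A i j) @^-1` B] >>.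

(* Each random matrix carries its own probability space: only laws of single
   random matrices are ever compared. *)
Record random_matrix (R : realType) (n r : nat) := RandomMatrix {
  mx_display : measure_display;
  mx_space : measurableType mx_display;
  mx_prob : probability mx_space R;
  mx_fun : mx_space -> 'M[R]_(n, r);
  mx_entry_measurable :
    forall (i : 'I_n) (j : 'I_r), measurable_fun setT (fun w => mx_fun w i j)
}.
Arguments mx_fun {R n r} _ _.

Definition law (R : realType) (n r : nat) (M : random_matrix R n r)
    (E : set 'M[R]_(n, r)) : \bar R :=
  mx_prob M (mx_fun M @^-1` E).

(* The columns of A indexed by J, in increasing order of the indices. *)
Definition columns (R : realType) (n p : nat) (J : {set 'I_p})
    (A : 'M[R]_(n, p)) : 'M[R]_(n, #|J|) :=
  colsub (fun k : 'I_#|J| => enum_val k) A.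

Definition singular_value_model (R : realType)
    (X : forall n r : nat, random_matrix R n r)
    (n p : nat) (M : random_matrix R n p) : Prop :=
  forall J : {set 'I_p},
    (0 < #|J|)%N -> (#|J|%:Z <= Num.ceil (2 * rho0 R * n%:R)) ->
    forall B, mx_measurable B ->
      law M [set A | B (columns J A)] = law (X n #|J|) B.

(* All r singular values of an n x r matrix A when r <= n: the square roots of
   the eigenvalues of A^T A. For r > n the standard list of min(n, r) singular
   values would leave out r - n zeros; that case is not used. *)
Definition singular_value (R : realType) (n r : nat) (A : 'M[R]_(n, r)) :
    set R :=
  [set s | 0 <= s /\ eigenvalue (A^T *m A) (s ^+ 2)].

(* The set of singular values is finite, and nonempty for r > 0, so the sup
   and the inf are the largest and the smallest singular value. *)
Definition sigma_max (R : realType) (n r : nat) (A : 'M[R]_(n, r)) : R :=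
  sup (singular_value A).

Definition sigma_min (R : realType) (n r : nat) (A : 'M[R]_(n, r)) : R :=
  inf (singular_value A).

Definition l2norm (R : realType) (m : nat) (x : 'cV[R]_m) : R :=
  Num.sqrt (\sum_(i < m) x i 0 ^+ 2).

Definition sparse (R : realType) (p s : nat) : set 'cV[R]_p :=
  [set x : 'cV[R]_p | (#|[pred i : 'I_p | (x i 0 != 0)%R]| <= s)%N].

(* In both restricted isometry constants the set is closed, nonempty and
   bounded below by 0, so the inf is a minimum. *)
Definition ric_min (R : realType) (n p s : nat) (A : 'M[R]_(n, p)) : R :=
  inf [set c : R | 0 <= c /\ forall x : 'cV[R]_p, sparse s x ->
         (1 - c) * l2norm x ^+ 2 <= l2norm (A *m x) ^+ 2].

Definition ric_max (R : realType) (n p s : nat) (A : 'M[R]_(n, p)) : R :=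
  inf [set c : R | 0 <= c /\ forall x : 'cV[R]_p, sparse s x ->
         (1 + c) * l2norm x ^+ 2 >= l2norm (A *m x) ^+ 2].

Definition ric_ratio (R : realType) (n p s : nat) (A : 'M[R]_(n, p)) :
    \bar R :=
  if ric_min s A == 1 then +oo%E
  else ((1 + ric_max s A) / (1 - ric_min s A))%:E.

(* Main.v *)
Require Import Defs.
From HB Require Import structures.
From mathcomp Require Import all_boot all_order all_algebra.
From mathcomp Require Import all_classical all_reals all_analysis.
From mathcomp Require Import measurable_realfun.
From mathcomp Require Import ring lra.

Set Implicit Arguments.
Unset Strict Implicit.
Unset Printing Implicit Defensive.
Import Order.TTheory GRing.Theory Num.Theory.
Import numFieldNormedType.Exports.
Local Open Scope classical_set_scope.
Local Open Scope ring_scope.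

(** Write [a = sqrt rhob] and [r = floor (rhob * n)].  A vector with at most
    [r] nonzero entries is carried by some set [J] of exactly [r] columns, and
    on vectors carried by [J] the extreme values of [|M x| / |x|] are the extreme
    singular values of [M_J].  Hence if no [M_J] deviates by [t], in the sense
    that [sigma_max < 1 + a + t] and [sigma_min > 1 - a - t], then
    [c_max <= (1 + a + t)^2 - 1] and [c_min <= 1 - (1 - a - t)^2]
    ([ric_le_of_not_deviates]).

    Each [M_J] has the law of [X_{r,n}], so by the union bound some [M_J]
    deviates with probability at most ['C(p, r) * c * exp (- n W(t))]
    ([law_le_of_deviates]).  One term of the binomial expansion of
    [(theta + (1 - theta))^p] is at most [1]; with [theta = rhob * delta] this
    gives ['C(p, r) <= exp (n (He theta / delta + o(1)))] ([near_binomial_le]).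
    The bound therefore decays exponentially as soon as
    [W(t) > He (rhob * delta) / delta] ([near_law_le_of_deviates]).

    The bounds on [c_min] and [c_max] follow with [t] slightly above [t_0], where
    [W(t_0) = He (rhob * delta) / delta].  For the bound on the ratio,
    [rhob = 2 * rho]; the condition on [delta] says that
    [W (sqrt (2 rho0) - a)] exceeds an upper bound for the entropy term, so by
    continuity some [t < sqrt (2 rho0) - a] is still admissible, and the ratio is
    then below [((1 + sqrt (2 rho0)) / (1 - sqrt (2 rho0)))^2], which is
    [(4 + sqrt 41)^2 / 25].

    A probability is only controlled on measurable sets, so all these events have
    to be measurable.  The singular values are compared with a level through the
    existence of a vector [x] satisfying a strict inequality between [|M x|^2] and
    [|x|^2]; by continuity [x] may be taken rational, which leaves a countable
    union ([measurable_exists_form]).  That the largest and smallest singular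
    values, defined from the eigenvalues of the Gram matrix, are the extrema of
    [|M x| / |x|] is shown in [sigma_max_rayleigh] and [sigma_min_rayleigh]. *)

(** * Extreme singular values as extrema of Rayleigh quotients *)

Section EuclideanNorm.
Context {R : realType}.

Lemma l2norm_sqr m (x : 'cV[R]_m) : l2norm x ^+ 2 = \sum_i x i 0 ^+ 2.
Proof. by rewrite /l2norm sqr_sqrtr// sumr_ge0// => i _; exact: sqr_ge0. Qed.

Lemma l2norm_sqrE m (x : 'cV[R]_m) : l2norm x ^+ 2 = (x^T *m x) 0 0.
Proof. by rewrite l2norm_sqr mxE; apply: eq_bigr => i _; rewrite !mxE. Qed.

Lemma mxED m n (A B : 'M[R]_(m, n)) i j : (A + B) i j = A i j + B i j.
Proof. by rewrite mxE. Qed.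

Lemma mxEB m n (A B : 'M[R]_(m, n)) i j : (A - B) i j = A i j - B i j.
Proof. by rewrite !mxE. Qed.

Lemma mxEZ m n a (A : 'M[R]_(m, n)) i j : (a *: A) i j = a * A i j.
Proof. by rewrite mxE. Qed.

Lemma l2norm_mul_sqrE n m (A : 'M[R]_(n, m)) (x : 'cV_m) :
  l2norm (A *m x) ^+ 2 = (x^T *m (A^T *m A) *m x) 0 0.
Proof. by rewrite l2norm_sqrE trmx_mul !mulmxA. Qed.

Lemma l2norm_sqr_gt0 m (x : 'cV[R]_m) : x != 0 -> 0 < l2norm x ^+ 2.
Proof.
apply: contraNT; rewrite -leNgt l2norm_sqr => le0.
have sq0 : \sum_i x i 0 ^+ 2 = 0.
  by apply/le_anti; rewrite le0 sumr_ge0// => i _; exact: sqr_ge0.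
apply/eqP/colP => i; rewrite mxE; apply/eqP; rewrite -sqrf_eq0.
by move/psumr_eq0P : sq0 => ->// j _; exact: sqr_ge0.
Qed.

Lemma normr_le_l2norm m (x : 'cV[R]_m) i : `|x i 0| <= l2norm x.
Proof.
rewrite -ler_sqr ?nnegrE ?sqrtr_ge0// real_normK ?num_real// l2norm_sqr.
by rewrite (bigD1 i)//= lerDl sumr_ge0// => j _; exact: sqr_ge0.
Qed.

Lemma l2norm_mul_bounded n m (A : 'M[R]_(n, m)) :
  exists2 C : R, 0 < C &
    forall x : 'cV_m, l2norm (A *m x) ^+ 2 <= C * l2norm x ^+ 2.
Proof.
exists (1 + \sum_i (\sum_j `|A i j|) ^+ 2) => [|x].
  by rewrite ltr_pwDl// sumr_ge0// => i _; exact: sqr_ge0.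
rewrite (l2norm_sqr (A *m x)) mulrDl mul1r ler_wpDl ?sqr_ge0//.
rewrite mulr_suml ler_sum// => i _.
rewrite -exprMn -(real_normK (num_real ((A *m x) i 0))) lerXn2r ?nnegrE//.
  by rewrite mulr_ge0 ?sqrtr_ge0// sumr_ge0.
rewrite mxE (le_trans (ler_norm_sum _ _ _))// mulr_suml ler_sum// => j _.
by rewrite normrM ler_wpM2l// normr_le_l2norm.
Qed.

(** Evaluating the form at [x - y / C], with [y = B x] and [C] a bound for [B],
    gives [|y|^2 <= C (x, B x)]; and [|x|] is bounded by [|y|] as [B] is
    invertible. *)
Lemma psd_unit_coercive m (B : 'M[R]_m) :
  B^T = B -> B \in unitmx ->
  (forall x : 'cV_m, 0 <= (x^T *m B *m x) 0 0) ->
  exists2 k : R, 0 < k &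
    forall x : 'cV_m, k * l2norm x ^+ 2 <= (x^T *m B *m x) 0 0.
Proof.
move=> symB unitB psdB.
have [D D0 leD] := l2norm_mul_bounded (invmx B).
have [C C0 leC] : exists2 C : R, 0 < C &
    forall x : 'cV_m, (x^T *m B *m x) 0 0 <= C * l2norm x ^+ 2.
  have [C C0 leC] := l2norm_mul_bounded B.
  exists (1 + C) => [|x]; first by rewrite addr_gt0.
  (* 2 (x, B x) <= |x|^2 + |B x|^2 *)
  have : 0 <= l2norm (x - B *m x) ^+ 2 by exact: sqr_ge0.
  have -> : l2norm (x - B *m x) ^+ 2 = l2norm x ^+ 2 + l2norm (B *m x) ^+ 2
      - (x^T *m B *m x) 0 0 *+ 2.
    rewrite !l2norm_sqrE [(x - _)^T]linearB/= trmx_mul symB.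
    by rewrite mulmxBl !mulmxBr !mulmxA !mxEB; ring.
  by have := leC x; have := psdB x; lra.
exists (C^-1 * D^-1) => [|x]; first by rewrite mulr_gt0 ?invr_gt0.
set q := (_ *m x) 0 0; set y := B *m x.
have leyq : C^-1 * l2norm y ^+ 2 <= q.
  have := psdB (x - C^-1 *: y).
  have -> : ((x - C^-1 *: y)^T *m B *m (x - C^-1 *: y)) 0 0 =
      q - C^-1 * l2norm y ^+ 2 *+ 2 + C^-1 ^+ 2 * (y^T *m B *m y) 0 0.
    rewrite [(x - _)^T]linearB/= [(_ *: y)^T]linearZ/= !mulmxBl !mulmxBr.
    rewrite -!scalemxAr -!scalemxAl.
    have -> : x^T *m B *m y = y^T *m y by rewrite /y trmx_mul symB.
    have -> : y^T *m B *m x = y^T *m y by rewrite -mulmxA.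
    rewrite l2norm_sqrE /q !mxEB !mxEZ; ring.
  have : C^-1 ^+ 2 * (y^T *m B *m y) 0 0 <= C^-1 * l2norm y ^+ 2.
    move: (leC y); set z : R := (_ *m y) 0 0 => lez.
    by rewrite expr2 -mulrA ler_pM2l ?invr_gt0// ler_pdivrMl.
  by lra.
apply: le_trans leyq; rewrite -mulrA ler_pM2l ?invr_gt0// ler_pdivrMl//.
by have := leD y; rewrite /y mulKmx.
Qed.

(** A positive semidefinite form whose Rayleigh quotients come arbitrarily close
    to [0] is singular, by [psd_unit_coercive]; with [e = 1] or [e = -1] this
    gives the smallest or the largest eigenvalue of [S]. *)
Lemma tight_form_eigenvalue m (S : 'M[R]_m) (b e : R) :
  S^T = S -> e * e = 1 ->
  (forall x : 'cV_m, 0 <= b * l2norm x ^+ 2 + e * (x^T *m S *m x) 0 0) ->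
  (forall k, 0 < k -> exists x : 'cV_m,
     b * l2norm x ^+ 2 + e * (x^T *m S *m x) 0 0 < k * l2norm x ^+ 2) ->
  eigenvalue S (- (e * b)).
Proof.
move=> symS ee1 psd tight.
pose B := b%:M + e *: S.
have formB (x : 'cV_m) : (x^T *m B *m x) 0 0 =
    b * l2norm x ^+ 2 + e * (x^T *m S *m x) 0 0.
  rewrite /B mulmxDr mulmxDl mul_mx_scalar -scalemxAr -!scalemxAl.
  by rewrite l2norm_sqrE mxED !mxEZ.
have symB : B^T = B by rewrite /B linearD/= linearZ/= tr_scalar_mx symS.
have [unitB|] := boolP (B \in unitmx).
  have [x|k k0 lek] := psd_unit_coercive symB unitB; first by rewrite formB.
  by have [x] := tight k k0; rewrite ltNge -formB lek.
rewrite unitmxE unitfE negbK => /det0P[v v0 vB].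
apply/eigenvalueP; exists v => //.
move: vB; rewrite /B mulmxDr mul_mx_scalar -scalemxAr => /eqP.
rewrite addr_eq0 => /eqP bv.
by rewrite scaleNr -scalerA bv scalerN opprK scalerA ee1 scale1r.
Qed.

End EuclideanNorm.

Section SingularValues.
Context {R : realType}.

(** Applied to the set of all constants admissible in a family of inequalities,
    this makes their infimum admissible. *)
Lemma le_inf_mul (S : set R) (f g : R) :
  0 <= g -> S !=set0 -> (forall c, S c -> f <= c * g) -> f <= inf S * g.
Proof.
rewrite le0r => /orP[/eqP-> [c /[swap] /[apply]]|g0 S0 fS].
  by rewrite !mulr0.
rewrite -ler_pdivrMr// lb_le_inf// => c Sc.
by rewrite ler_pdivrMr// fS.
Qed.

Lemma singular_value_vector n m (A : 'M[R]_(n, m)) s : singular_value A s ->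
  0 <= s /\
  exists2 x : 'cV_m, x != 0 & l2norm (A *m x) ^+ 2 = s ^+ 2 * l2norm x ^+ 2.
Proof.
move=> [s0 /eigenvalueP[v vS v0]]; split => //; exists v^T.
  by apply: contra v0 => /eqP v0; rewrite -(trmxK v) v0 trmx0.
by rewrite l2norm_mul_sqrE l2norm_sqrE trmxK vS -scalemxAl mxEZ.
Qed.

Lemma gram_symmetric n m (A : 'M[R]_(n, m)) : (A^T *m A)^T = A^T *m A.
Proof. by rewrite trmx_mul trmxK. Qed.

Lemma const_mx1_neq0 m : (0 < m)%N -> (const_mx 1 : 'cV[R]_m) != 0.
Proof.
move=> m0; apply/eqP => /colP /(_ (Ordinal m0)); rewrite !mxE => /eqP.
by rewrite oner_eq0.
Qed.

(** The least bound of the Rayleigh quotients is tight, hence an eigenvalue of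
    the Gram matrix by [tight_form_eigenvalue], and it bounds every other
    eigenvalue. *)
Lemma sigma_max_rayleigh n m (A : 'M[R]_(n, m)) : (0 < m)%N ->
  singular_value A (sigma_max A) /\
  forall x : 'cV_m, l2norm (A *m x) ^+ 2 <= sigma_max A ^+ 2 * l2norm x ^+ 2.
Proof.
move=> m0.
pose S := [set c | forall x : 'cV_m, l2norm (A *m x) ^+ 2 <= c * l2norm x ^+ 2].
have S0 : S !=set0 by have [C _ leC] := l2norm_mul_bounded A; exists C.
have S_ge0 c : S c -> 0 <= c.
  move=> /(_ (const_mx 1)) /(le_trans (sqr_ge0 _)).
  by rewrite pmulr_lge0// l2norm_sqr_gt0// const_mx1_neq0.
have lbS : has_lbound S by exists 0 => c /S_ge0.
have infS : S (inf S).
  by move=> y; apply: le_inf_mul; rewrite ?sqr_ge0// => c; apply.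
have tight k : 0 < k -> exists y : 'cV_m,
    inf S * l2norm y ^+ 2 + (- 1) * (y^T *m (A^T *m A) *m y) 0 0
      < k * l2norm y ^+ 2.
  move=> k0; apply: contrapT => /forallNP no.
  have /(ge_inf lbS) : S (inf S - k).
    by move=> y; have /negP := no y; rewrite -leNgt -l2norm_mul_sqrE; lra.
  by lra.
have eig : eigenvalue (A^T *m A) (inf S).
  have -> : inf S = - (-1 * inf S) by rewrite mulN1r opprK.
  apply: tight_form_eigenvalue tight; first exact: gram_symmetric.
    by rewrite mulrNN mulr1.
  by move=> y; rewrite -l2norm_mul_sqrE; have := infS y; lra.
have inf0 : 0 <= inf S by exact: lb_le_inf.
have svinf : singular_value A (Num.sqrt (inf S)).
  by split; rewrite ?sqrtr_ge0// sqr_sqrtr.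
suff -> : sigma_max A = Num.sqrt (inf S) by split; rewrite ?sqr_sqrtr.
have ubsv : ubound (singular_value A) (Num.sqrt (inf S)).
  move=> s /singular_value_vector[s0 [y y0 Ay]].
  rewrite -ler_sqr ?nnegrE ?sqrtr_ge0// sqr_sqrtr//.
  by rewrite -(ler_pM2r (l2norm_sqr_gt0 y0)) -Ay.
apply/le_anti/andP; split.
  by apply: ge_sup => //; exists (Num.sqrt (inf S)).
by apply: ub_le_sup => //; exists (Num.sqrt (inf S)).
Qed.

Lemma sigma_min_rayleigh n m (A : 'M[R]_(n, m)) : (0 < m)%N ->
  singular_value A (sigma_min A) /\
  forall x : 'cV_m, sigma_min A ^+ 2 * l2norm x ^+ 2 <= l2norm (A *m x) ^+ 2.
Proof.
move=> m0.
pose S := [set c | forall x : 'cV_m,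
  - l2norm (A *m x) ^+ 2 <= c * l2norm x ^+ 2].
have S_0 : S 0 by move=> x; rewrite mul0r oppr_le0 sqr_ge0.
have lbS : has_lbound S.
  have [C _ leC] := l2norm_mul_bounded A; exists (- C) => c Sc.
  have := l2norm_sqr_gt0 (const_mx1_neq0 m0) => pos.
  rewrite -(ler_pM2r pos) (le_trans _ (Sc _))//.
  by rewrite mulNr lerN2.
have infS : S (inf S).
  by move=> y; apply: le_inf_mul; rewrite ?sqr_ge0//; exists 0.
have tight k : 0 < k -> exists y : 'cV_m,
    inf S * l2norm y ^+ 2 + 1 * (y^T *m (A^T *m A) *m y) 0 0
      < k * l2norm y ^+ 2.
  move=> k0; apply: contrapT => /forallNP no.
  have /(ge_inf lbS) : S (inf S - k).
    by move=> y; have /negP := no y; rewrite -leNgt -l2norm_mul_sqrE; lra.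
  by lra.
have eig : eigenvalue (A^T *m A) (- inf S).
  have -> : - inf S = - (1 * inf S) by rewrite mul1r.
  apply: tight_form_eigenvalue tight; rewrite ?gram_symmetric ?mulr1//.
  by move=> y; rewrite -l2norm_mul_sqrE; have := infS y; lra.
have inf0 : 0 <= - inf S by rewrite oppr_ge0; exact: ge_inf.
have svinf : singular_value A (Num.sqrt (- inf S)).
  by split; rewrite ?sqrtr_ge0// sqr_sqrtr.
suff -> : sigma_min A = Num.sqrt (- inf S).
  by split => // x; rewrite sqr_sqrtr// mulNr lerNl.
have lbsv : lbound (singular_value A) (Num.sqrt (- inf S)).
  move=> s /singular_value_vector[s0 [y y0 Ay]].
  rewrite -ler_sqr ?nnegrE ?sqrtr_ge0// sqr_sqrtr//.
  by rewrite -(ler_pM2r (l2norm_sqr_gt0 y0)) -Ay mulNr lerNl.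
apply/le_anti/andP; split.
  by apply: ge_inf => //; exists (Num.sqrt (- inf S)).
by apply: lb_le_inf => //; exists (Num.sqrt (- inf S)).
Qed.

Lemma sigma_max_gt n m (A : 'M[R]_(n, m)) t : (0 < m)%N -> 0 <= t ->
  t < sigma_max A <->
  exists x : 'cV_m, t ^+ 2 * l2norm x ^+ 2 < l2norm (A *m x) ^+ 2.
Proof.
move=> m0 t0; have [sv le_sigma] := sigma_max_rayleigh A m0.
have [sigma0 [y y0 Ay]] := singular_value_vector sv.
split=> [lt_t|[x lt_x]].
  by exists y; rewrite Ay ltr_pM2r ?l2norm_sqr_gt0// ltr_sqr ?nnegrE.
rewrite -ltr_sqr ?nnegrE//.
have := lt_le_trans lt_x (le_sigma x).
by apply: contraTT; rewrite -!leNgt => ?; rewrite ler_wpM2r ?sqr_ge0.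
Qed.

Lemma sigma_min_lt n m (A : 'M[R]_(n, m)) t : (0 < m)%N -> 0 <= t ->
  sigma_min A < t <->
  exists x : 'cV_m, l2norm (A *m x) ^+ 2 < t ^+ 2 * l2norm x ^+ 2.
Proof.
move=> m0 t0; have [sv le_sigma] := sigma_min_rayleigh A m0.
have [sigma0 [x x0 Ax]] := singular_value_vector sv.
split=> [lt_t|[y lt_y]].
  by exists x; rewrite Ax ltr_pM2r ?l2norm_sqr_gt0// ltr_sqr ?nnegrE.
rewrite -ltr_sqr ?nnegrE//.
have := le_lt_trans (le_sigma y) lt_y.
by apply: contraTT; rewrite -!leNgt => ?; rewrite ler_wpM2r ?sqr_ge0.
Qed.

End SingularValues.

(** * Restricted isometry constants from singular values of submatrices *)

Section RestrictedIsometry.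
Context {R : realType}.

Section Characterization.
Variables (n p s : nat) (A : 'M[R]_(n, p)).

Let Smin := [set c : R | 0 <= c /\ forall x : 'cV[R]_p, sparse s x ->
  (1 - c) * l2norm x ^+ 2 <= l2norm (A *m x) ^+ 2].

Let Smax := [set c : R | 0 <= c /\ forall x : 'cV[R]_p, sparse s x ->
  (1 + c) * l2norm x ^+ 2 >= l2norm (A *m x) ^+ 2].

Let Smin1 : Smin 1.
Proof. by split=> // x _; rewrite subrr mul0r sqr_ge0. Qed.

Let Smax0 : Smax !=set0.
Proof.
have [C C0 leC] := l2norm_mul_bounded A; exists C; split=> [|x _].
  exact: ltW.
by rewrite (le_trans (leC x))// ler_wpM2r ?sqr_ge0// lerDr.
Qed.

Let lbSmin : has_lbound Smin. Proof. by exists 0 => c []. Qed.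

Let lbSmax : has_lbound Smax. Proof. by exists 0 => c []. Qed.

Lemma ric_min_ge0 : 0 <= ric_min s A.
Proof. by apply: lb_le_inf => [|c []//]; exists 1. Qed.

Lemma ric_max_ge0 : 0 <= ric_max s A.
Proof. by apply: lb_le_inf => [|c []]. Qed.

Lemma ric_min_le1 : ric_min s A <= 1.
Proof. exact: ge_inf. Qed.

Lemma ric_min_leP a : 0 <= a -> ric_min s A <= a <->
  forall x : 'cV_p, sparse s x ->
    (1 - a) * l2norm x ^+ 2 <= l2norm (A *m x) ^+ 2.
Proof.
move=> a0; split=> [le_a x sx|ok]; last by apply: ge_inf.
suff : l2norm x ^+ 2 - l2norm (A *m x) ^+ 2 <= ric_min s A * l2norm x ^+ 2.
  have := ler_wpM2r (sqr_ge0 (l2norm x)) le_a; lra.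
apply: le_inf_mul; rewrite ?sqr_ge0//; first by exists 1.
by move=> c [_ /(_ x sx)]; lra.
Qed.

Lemma ric_max_leP a : 0 <= a -> ric_max s A <= a <->
  forall x : 'cV_p, sparse s x ->
    l2norm (A *m x) ^+ 2 <= (1 + a) * l2norm x ^+ 2.
Proof.
move=> a0; split=> [le_a x sx|ok]; last by apply: ge_inf.
suff : l2norm (A *m x) ^+ 2 - l2norm x ^+ 2 <= ric_max s A * l2norm x ^+ 2.
  have := ler_wpM2r (sqr_ge0 (l2norm x)) le_a; lra.
apply: le_inf_mul; rewrite ?sqr_ge0//.
by move=> c [_ /(_ x sx)]; lra.
Qed.

End Characterization.

Lemma card_superset (T : finType) (J : {set T}) r :
  (#|J| <= r <= #|T|)%N -> exists2 K : {set T}, J \subset K & #|K| = r.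
Proof.
elim: r => [|r IHr].
  by rewrite leqn0 => /andP[/eqP J0 _]; exists J.
move=> /andP[]; rewrite leq_eqVlt => /orP[/eqP <- _|]; first by exists J.
rewrite ltnS => Jr rT; have [|K JK Kr] := IHr; first by rewrite Jr ltnW.
have /card_gt0P[x] : (0 < #|~: K|)%N.
  by rewrite cardsCs finset.setCK Kr subn_gt0.
rewrite inE => /negbTE xK.
exists (x |: K); last by rewrite cardsU1 xK Kr.
by rewrite (fintype.subset_trans JK)// finset.subsetU1.
Qed.

(** The support is enlarged to have exactly [r] elements, because the model
    gives the law of [M_J] in terms of the cardinal of [J]. *)
Lemma columns_sparse n p r (A : 'M[R]_(n, p)) (x : 'cV_p) :
  (r <= p)%N -> sparse r x ->
  exists2 J : {set 'I_p}, #|J| = r & exists2 y : 'cV_#|J|,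
    columns J A *m y = A *m x & l2norm y = l2norm x.
Proof.
move=> rp sx.
have [|J supJ cardJ] := @card_superset _ [set i | x i 0 != 0] r.
  by rewrite cardsE card_ord rp andbT.
have x0 i : i \notin J -> x i 0 = 0.
  by apply: contraNeq => xi0; apply: (fintype.subsetP supJ); rewrite inE.
exists J => //; exists (\col_k x (enum_val k) 0).
  apply/colP => i; rewrite !mxE.
  rewrite (bigID (mem J))/= [X in _ = _ + X]big1 => [|j /x0->]; last first.
    by rewrite mulr0.
  rewrite addr0 [RHS]big_enum_val/=; apply: eq_bigr => k _.
  by rewrite !mxE.
rewrite /l2norm; congr Num.sqrt.
rewrite [RHS](bigID (mem J))/= [X in _ = _ + X]big1 => [|j /x0->]; last first.
  by rewrite expr0n.
by rewrite addr0 [RHS]big_enum_val/=; apply: eq_bigr => k _; rewrite !mxE.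
Qed.

(** The event of the deviation hypothesis, with [a] for [sqrt rhob]. *)
Definition deviates (a t : R) n r : set 'M[R]_(n, r) :=
  [set A | (t <= Num.max (sigma_max A - (1 + a)) ((1 - a) - sigma_min A))%R].

Lemma not_deviates_frame a t n m (A : 'M[R]_(n, m)) (x : 'cV_m) : (0 < m)%N ->
  0 <= a + t <= 1 -> ~ deviates a t A ->
  (1 - (a + t)) ^+ 2 * l2norm x ^+ 2 <= l2norm (A *m x) ^+ 2
    <= (1 + (a + t)) ^+ 2 * l2norm x ^+ 2.
Proof.
move=> m0 /andP[at0 at1] /negP; rewrite -ltNge gt_max => /andP[ltmax ltmin].
apply/andP; split; rewrite leNgt; apply/negP => ltx.
  have /(sigma_min_lt A m0) : 0 <= 1 - (a + t) by lra.
  case=> _ /(_ (ex_intro _ x ltx)).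
  by lra.
have /(sigma_max_gt A m0) : 0 <= 1 + (a + t) by lra.
case=> _ /(_ (ex_intro _ x ltx)).
by lra.
Qed.

(** The number [s] may be smaller than [r]: control at the largest sparsity
    level serves for all the lower ones at once. *)
Lemma ric_le_of_not_deviates a t n p r s (A : 'M[R]_(n, p)) :
  (0 < r)%N -> (s <= r <= p)%N -> 0 <= a + t <= 1 ->
  (forall J : {set 'I_p}, #|J| = r -> ~ deviates a t (columns J A)) ->
  ric_min s A <= 1 - (1 - (a + t)) ^+ 2 /\
  ric_max s A <= (1 + (a + t)) ^+ 2 - 1.
Proof.
move=> r0 /andP[sr rp] at01 nodev.
have frame x : sparse s x ->
    (1 - (a + t)) ^+ 2 * l2norm x ^+ 2 <= l2norm (A *m x) ^+ 2
      <= (1 + (a + t)) ^+ 2 * l2norm x ^+ 2.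
  move=> sx; have [|J cardJ [y <- <-]] := @columns_sparse n p r A x rp.
    exact: leq_trans sx sr.
  by apply: not_deviates_frame; rewrite ?cardJ//; exact: nodev.
move: at01 => /andP[at0 at1].
split.
  apply/ric_min_leP => [|x /frame/andP[+ _]]; first by nra.
  by rewrite subKr.
apply/ric_max_leP => [|x /frame/andP[_]]; first by nra.
by rewrite [1 + (_ - 1)]addrC subrK.
Qed.

(** Where [ric_min s A = 1] the right-hand condition fails, since
    [ric_max s A >= 0]. *)
Lemma ric_ratio_ltP n p s (A : 'M[R]_(n, p)) (K : R) :
  (ric_ratio s A < K%:E)%E <-> 1 + ric_max s A < K * (1 - ric_min s A).
Proof.
have le1 := ric_min_le1 s A; have max0 := ric_max_ge0 s A.
rewrite /ric_ratio; case: eqVneq => [->|ne1].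
  by rewrite subrr mulr0; split=> [|?]; [rewrite ltNge leey|exfalso; lra].
have lt1 : ric_min s A < 1 by rewrite lt_neqAle ne1.
by rewrite lte_fin ltr_pdivrMr ?subr_gt0.
Qed.

Lemma ric_ratio_lt n p s (A : 'M[R]_(n, p)) (u v K : R) : 0 < u ->
  ric_min s A <= 1 - u ^+ 2 -> ric_max s A <= v ^+ 2 - 1 ->
  v ^+ 2 < K * u ^+ 2 -> (ric_ratio s A < K%:E)%E.
Proof.
move=> u0 lemin lemax ltK; apply/ric_ratio_ltP.
have K0 : 0 < K.
  by rewrite -(pmulr_lgt0 K (exprn_gt0 2 u0)) (le_lt_trans _ ltK)// sqr_ge0.
have : K * u ^+ 2 <= K * (1 - ric_min s A) by rewrite ler_pM2l//; lra.
by lra.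
Qed.

End RestrictedIsometry.

Arguments deviates {R} a t {n r} _.

(** * Measurability *)

Section Measurability.
Context {R : realType}.

Definition entries_measurable d (T : measurableType d) n m
    (f : T -> 'M[R]_(n, m)) :=
  forall i j, measurable_fun setT (fun w => f w i j).

Lemma mx_measurable_preimage d (T : measurableType d) n m
    (f : T -> 'M[R]_(n, m)) : entries_measurable f ->
  forall B, mx_measurable B -> measurable (f @^-1` B).
Proof.
move=> mf B; rewrite -[f @^-1` B]setTI; move: B.
apply: smallest_sub.
  exact: sigma_algebra_image (@sigma_algebra_measurable _ T).
move=> _ [i [j [B [mB ->]]]]; exact: mf.
Qed.

Lemma entries_measurable_columns d (T : measurableType d) n p
    (f : T -> 'M[R]_(n, p)) (J : {set 'I_p}) :
  entries_measurable f -> entries_measurable (fun w => columns J (f w)).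
Proof.
by move=> mf i j; under eq_fun do rewrite mxE; exact: mf.
Qed.

(** The identity is the random matrix that carries the entrywise sigma-algebra
    itself, so that measurability of the events of every random matrix gives
    measurability for the laws. *)
Lemma entries_measurable_mx_measurable n m (B : set 'M[R]_(n, m)) :
  (forall d (T : measurableType d) (f : T -> 'M[R]_(n, m)),
     entries_measurable f -> measurable (f @^-1` B)) ->
  mx_measurable B.
Proof.
pose G := [set E | exists (i : 'I_n) (j : 'I_m) (B : set R),
  measurable B /\ E = (fun A : 'M[R]_(n, m) => A i j) @^-1` B].
move=> /(_ _ (g_sigma_algebraType G) id); apply => i j _ C mC.
by rewrite setTI; apply: sub_sigma_algebra; exists i, j, C.
Qed.

Lemma measurable_l2norm_mul d (T : measurableType d) n m
    (f : T -> 'M[R]_(n, m)) (x : 'cV_m) : entries_measurable f ->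
  measurable_fun setT (fun w => l2norm (f w *m x) ^+ 2).
Proof.
move=> mf; under eq_fun do rewrite l2norm_sqr.
apply: measurable_sum => i.
apply: measurable_funX; under eq_fun do rewrite mxE.
apply: measurable_sum => j.
by apply: measurable_funM => //; exact: mf.
Qed.

Lemma cvg_l2norm_mul n m (A : 'M[R]_(n, m)) (y : nat -> 'cV_m) (x : 'cV_m) :
  (forall j, y k j 0 @[k --> \oo] --> x j 0) ->
  l2norm (A *m y k) ^+ 2 @[k --> \oo] --> l2norm (A *m x) ^+ 2.
Proof.
move=> yx; rewrite l2norm_sqr; under eq_fun do rewrite l2norm_sqr.
have cvgA i : (A *m y k) i 0 @[k --> \oo] --> (A *m x) i 0.
  under eq_fun do rewrite mxE.
  rewrite mxE; apply: cvg_big => [|j _]; first exact: add_continuous.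
  by apply: cvgM => //; exact: cvg_cst.
apply: cvg_big => [|i _]; first exact: add_continuous.
by apply: cvgM; exact: cvgA.
Qed.

Lemma rational_approximation m (x : 'cV[R]_m) :
  exists q : nat -> 'cV[rat]_m,
    forall j, (ratr (q k j 0) : R) @[k --> \oo] --> x j 0.
Proof.
have /choice[q qP] : forall k, exists q : 'I_m -> rat,
    forall j, x j 0 < ratr (q j) < x j 0 + k.+1%:R^-1.
  move=> k.
  have /choice[q qP] : forall j, exists q : rat,
      x j 0 < ratr q < x j 0 + k.+1%:R^-1.
    move=> j; have [|q] := @rat_in_itvoo R (x j 0) (x j 0 + k.+1%:R^-1).
      by rewrite ltrDl invr_gt0.
    by rewrite in_itv/=; exists q.
  by exists q.
exists (fun k => \col_j q k j) => j; under eq_fun do rewrite mxE.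
apply: (@squeeze_cvgr _ _ _ _ (fun=> x j 0) (fun k => x j 0 + k.+1%:R^-1)).
- by apply: nearW => k; have /andP[/ltW-> /ltW->] := qP k j.
- exact: cvg_cst.
- rewrite -[X in _ --> X]addr0; apply: cvgD; first exact: cvg_cst.
  exact: cvg_harmonic.
Qed.

(** By continuity in [x], rational vectors suffice, and they are countably
    many. *)
Lemma measurable_exists_form d (T : measurableType d) n m
    (f : T -> 'M[R]_(n, m)) (J : {set 'I_m}) (a b : R) :
  entries_measurable f ->
  measurable [set w | exists x : 'cV_m, (forall i, i \notin J -> x i 0 = 0) /\
    0 < a * l2norm (f w *m x) ^+ 2 + b * l2norm x ^+ 2].
Proof.
move=> mf.
pose y (q : 'cV[rat]_m) : 'cV[R]_m :=
  \col_i if i \in J then ratr (q i 0) else 0.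
pose g (A : 'M[R]_(n, m)) x := a * l2norm (A *m x) ^+ 2 + b * l2norm x ^+ 2.
rewrite [X in measurable X](_ : _ = \bigcup_q [set w | 0 < g (f w) (y q)]).
  apply: countable_bigcupT_measurable => [|q]; first exact: countableP.
  have mg : measurable_fun setT (fun w => g (f w) (y q)).
    apply: measurable_funD => //; apply: measurable_funM => //.
    exact: measurable_l2norm_mul.
  have := mg measurableT `]0, +oo[%classic (measurable_itv _).
  rewrite setTI; congr measurable; apply/seteqP.
  by split => w /=; rewrite in_itv/= andbT.
apply/seteqP; split=> w /=; last first.
  by case=> q _ gq; exists (y q); split=> // i /negbTE iJ; rewrite mxE iJ.
case=> x [supx gx]; have [q qx] := rational_approximation x.
have yx j : y (q k) j 0 @[k --> \oo] --> x j 0.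
  under eq_fun do rewrite mxE.
  by case: (boolP (j \in J)) => [_|/supx->]; [exact: qx|exact: cvg_cst].
have : g (f w) (y (q k)) @[k --> \oo] --> g (f w) x.
  apply: cvgD; (apply: cvgM; first exact: cvg_cst).
    exact: cvg_l2norm_mul.
  have := @cvg_l2norm_mul _ _ 1%:M _ _ yx.
  by rewrite mul1mx; under eq_fun do rewrite mul1mx.
move/cvgr_gt => /(_ 0 gx) [k _ /(_ k (leqnn k))/= gk].
by exists (q k).
Qed.

Lemma measurable_sigma_max d (T : measurableType d) n m
    (f : T -> 'M[R]_(n, m)) : (0 < m)%N -> entries_measurable f ->
  measurable_fun setT (fun w => sigma_max (f w)).
Proof.
move=> m0 mf; apply: (measurability _ (RGenOInfty.measurableE R)).
move=> _ [_ [t ->] <-]; rewrite setTI.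
have [t0|t0] := leP 0 t; last first.
  rewrite [X in measurable X](_ : _ = setT)//; apply/seteqP; split=> // w _.
  rewrite /= in_itv/= andbT (lt_le_trans t0)//.
  by have [[]] := sigma_max_rayleigh (f w) m0.
have := measurable_exists_form finset.setT 1 (- t ^+ 2) mf.
congr measurable; apply/seteqP.
split=> w /=; rewrite in_itv/= andbT.
  case=> x [_ fx]; apply/(sigma_max_gt _ m0 t0); exists x; lra.
case/(sigma_max_gt _ m0 t0) => x fx; exists x; split=> [i|]; last by lra.
by rewrite inE.
Qed.

Lemma measurable_sigma_min d (T : measurableType d) n m
    (f : T -> 'M[R]_(n, m)) : (0 < m)%N -> entries_measurable f ->
  measurable_fun setT (fun w => sigma_min (f w)).
Proof.
move=> m0 mf; apply: (measurability _ (RGenInftyO.measurableE R)).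
move=> _ [_ [t ->] <-]; rewrite setTI.
have [t0|t0] := leP 0 t; last first.
  rewrite [X in measurable X](_ : _ = set0)//; apply/seteqP; split=> // w.
  rewrite /= in_itv/= => /lt_trans/(_ t0); rewrite ltNge.
  by have [[->]] := sigma_min_rayleigh (f w) m0.
have := measurable_exists_form finset.setT (-1) (t ^+ 2) mf.
congr measurable; apply/seteqP.
split=> w /=; rewrite in_itv/=.
  case=> x [_ fx]; apply/(sigma_min_lt _ m0 t0); exists x; lra.
case/(sigma_min_lt _ m0 t0) => x fx; exists x; split=> [i|]; last by lra.
by rewrite inE.
Qed.

Lemma measurable_deviates d (T : measurableType d) n m a t
    (f : T -> 'M[R]_(n, m)) : (0 < m)%N -> entries_measurable f ->
  measurable [set w | deviates a t (f w)].
Proof.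
move=> m0 mf.
have mg : measurable_fun setT (fun w => Num.max (sigma_max (f w) - (1 + a))
    ((1 - a) - sigma_min (f w))).
  apply: measurable_maxr; apply: measurable_funB => //.
    exact: measurable_sigma_max.
  exact: measurable_sigma_min.
have := mg measurableT `[t, +oo[%classic (measurable_itv _).
rewrite setTI; congr measurable; apply/seteqP.
by split => w /=; rewrite in_itv/= andbT.
Qed.

Lemma measurable_deviates_columns d (T : measurableType d) n p a t
    (f : T -> 'M[R]_(n, p)) (J : {set 'I_p}) : entries_measurable f ->
  (0 < #|J|)%N -> measurable [set w | deviates a t (columns J (f w))].
Proof.
move=> mf J0.
exact: (measurable_deviates a t J0 (entries_measurable_columns (J := J) mf)).
Qed.

Lemma mx_measurable_deviates n m a t : (0 < m)%N ->
  mx_measurable (@deviates R a t n m).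
Proof.
move=> m0; apply: entries_measurable_mx_measurable => d T f.
exact: measurable_deviates.
Qed.

(** Sparse vectors form a finite union of coordinate subspaces. *)
Lemma measurable_exists_sparse d (T : measurableType d) n p s
    (f : T -> 'M[R]_(n, p)) (a b : R) : entries_measurable f ->
  measurable [set w | exists x : 'cV_p, sparse s x /\
    0 < a * l2norm (f w *m x) ^+ 2 + b * l2norm x ^+ 2].
Proof.
move=> mf; pose E (J : {set 'I_p}) := [set w | exists x : 'cV_p,
  (forall i, i \notin J -> x i 0 = 0) /\
  0 < a * l2norm (f w *m x) ^+ 2 + b * l2norm x ^+ 2].
rewrite [X in measurable X](_ : _ =
      \bigcup_(J in [set J : {set 'I_p} | (#|J| <= s)%N]) E J).
  apply: fin_bigcup_measurable => // J _; exact: measurable_exists_form.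
apply/seteqP; split=> w /=.
  case=> x [sx fx]; exists [set i | x i 0 != 0]%SET.
    by rewrite /= cardsE.
  by exists x; split=> // i; rewrite inE negbK => /eqP.
case=> J /= Js [x [supx fx]]; exists x; split=> //.
apply: leq_trans Js; apply: subset_leq_card; apply/fintype.subsetP => i.
by rewrite inE; apply: contraNT => /supx->.
Qed.

Lemma measurable_ric_min d (T : measurableType d) n p s
    (f : T -> 'M[R]_(n, p)) : entries_measurable f ->
  measurable_fun setT (fun w => ric_min s (f w)).
Proof.
move=> mf; apply: (measurability _ (RGenOInfty.measurableE R)).
move=> _ [_ [t ->] <-]; rewrite setTI.
have [t0|t0] := leP 0 t; last first.
  rewrite [X in measurable X](_ : _ = setT)//; apply/seteqP; split=> // w _.
  by rewrite /= in_itv/= andbT (lt_le_trans t0)// ric_min_ge0.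
have := measurable_exists_sparse s (-1) (1 - t) mf.
congr measurable; apply/seteqP.
split=> w /=; rewrite in_itv/= andbT.
  case=> x [sx fx]; rewrite ltNge; apply/negP => /(ric_min_leP _ _ t0).
  by move=> /(_ x sx); lra.
move=> lt_t; apply: contrapT => /forallNP no; move: lt_t.
rewrite ltNge => /negP; apply; apply/ric_min_leP => // x sx.
by rewrite leNgt; apply/negP => lt_x; apply: (no x); split=> //; lra.
Qed.

Lemma measurable_ric_max d (T : measurableType d) n p s
    (f : T -> 'M[R]_(n, p)) : entries_measurable f ->
  measurable_fun setT (fun w => ric_max s (f w)).
Proof.
move=> mf; apply: (measurability _ (RGenOInfty.measurableE R)).
move=> _ [_ [t ->] <-]; rewrite setTI.
have [t0|t0] := leP 0 t; last first.
  rewrite [X in measurable X](_ : _ = setT)//; apply/seteqP; split=> // w _.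
  by rewrite /= in_itv/= andbT (lt_le_trans t0)// ric_max_ge0.
have := measurable_exists_sparse s 1 (- (1 + t)) mf.
congr measurable; apply/seteqP.
split=> w /=; rewrite in_itv/= andbT.
  case=> x [sx fx]; rewrite ltNge; apply/negP => /(ric_max_leP _ _ t0).
  by move=> /(_ x sx); lra.
move=> lt_t; apply: contrapT => /forallNP no; move: lt_t.
rewrite ltNge => /negP; apply; apply/ric_max_leP => // x sx.
by rewrite leNgt; apply/negP => lt_x; apply: (no x); split=> //; lra.
Qed.

Lemma measurable_ric_ratio_lt d (T : measurableType d) n p s K
    (f : T -> 'M[R]_(n, p)) : entries_measurable f ->
  measurable [set w | (ric_ratio s (f w) < K%:E)%E].
Proof.
move=> mf.
have mg : measurable_fun setT
    (fun w => K * (1 - ric_min s (f w)) - (1 + ric_max s (f w))).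
  apply: measurable_funB.
    apply: measurable_funM => //; apply: measurable_funB => //.
    exact: measurable_ric_min.
  by apply: measurable_funD => //; exact: measurable_ric_max.
have := mg measurableT `]0, +oo[%classic (measurable_itv _).
rewrite setTI; congr measurable; apply/seteqP.
split=> w /=; rewrite in_itv/= andbT subr_gt0; by move/ric_ratio_ltP.
Qed.

End Measurability.

(** * Entropy bound and union bound over supports *)

Section EntropyBound.
Context {R : realType}.

(** A single term of the binomial expansion of [(theta + (1 - theta)) ^+ p = 1]
    is at most [1]. *)
Lemma bin_le_expR (p r : nat) (theta : R) : 0 < theta < 1 -> (r <= p)%N ->
  'C(p, r)%:R <=
    expR (- (r%:R * ln theta) - (p%:R - r%:R) * ln (1 - theta)).
Proof.
move=> /andP[th0 th1] rp.
have th1' : 0 < 1 - theta by rewrite subr_gt0.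
rewrite -natrB// -opprD expRN expRD !expRM_natl !lnK ?posrE//.
rewrite -[leRHS]mul1r ler_pdivlMr ?mulr_gt0 ?exprn_gt0//.
have : (1 - theta + theta) ^+ p = 1 by rewrite subrK expr1n.
rewrite exprDn (bigD1 (Ordinal (rp : (r < p.+1)%N)))//= => sum1.
rewrite -[leRHS]sum1 [theta ^+ r * _]mulrC mulr_natl lerDl.
rewrite sumr_ge0// => i _.
by rewrite mulrn_wge0// mulr_ge0// exprn_ge0// ltW.
Qed.

(** Any [delta' < delta] gives the explicit bound [p <= n / delta'], which
    replaces the limit in the estimate of the exponent. *)
Lemma near_dimension (p : nat -> nat) (delta delta' : R) :
  0 < delta' < delta -> delta < 1 ->
  (n%:R / (p n)%:R : R) @[n --> \oo] --> delta ->
  \forall n \near \oo, (n <= p n)%N /\ ((p n)%:R : R) <= n%:R / delta'.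
Proof.
move=> /andP[d'0 d'd] d1 cvg.
have lo := cvgr_gt delta cvg _ d'd.
have hi := cvgr_lt delta cvg _ d1.
near=> n.
have lo_n : delta' < n%:R / (p n)%:R by near: n; exact: lo.
have hi_n : n%:R / (p n)%:R < 1 :> R by near: n; exact: hi.
have p0 : 0 < (p n)%:R :> R.
  rewrite ltr0n lt0n; apply/negP => /eqP p0.
  by move: lo_n; rewrite p0 invr0 mulr0 ltNge ltW.
split; last by rewrite ler_pdivlMr// mulrC -ler_pdivlMr// ltW.
by move: hi_n; rewrite ltr_pdivrMr// mul1r ltr_nat => /ltnW.
Unshelve. all: by end_near. Qed.

(** With [theta = rhob * delta] in [bin_le_expR] the exponent is
    asymptotically [n / delta * He (rhob * delta)]. *)
Lemma near_binomial_le (p : nat -> nat) (delta rhob e : R) :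
  0 < delta < 1 -> 0 < rhob < 1 -> 0 < e ->
  (n%:R / (p n)%:R : R) @[n --> \oo] --> delta ->
  \forall n \near \oo,
    (0 < Num.truncn (rhob * n%:R) <= p n)%N /\
    'C(p n, Num.truncn (rhob * n%:R))%:R <=
      expR (n%:R * (delta^-1 * He (rhob * delta) + e)).
Proof.
move=> /andP[d0 d1] /andP[r0 r1] e0 cvg.
set th := rhob * delta.
have th0 : 0 < th by rewrite mulr_gt0.
have th1 : th < 1.
  by rewrite (lt_trans _ d1)// /th gtr_pMl.
pose a := - ln th; pose L := - ln (1 - th).
have a0 : 0 <= a by rewrite oppr_ge0 ln_le0// ltW.
have L0 : 0 <= L by rewrite oppr_ge0 ln_le0//; lra.
(* An excess eta of p / n over 1 / delta costs n * eta * L in the exponent, and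
   rounding rhob * n down to r costs at most L; e has to cover both. *)
pose eta := e / (L + 1).
have eta0 : 0 < eta by rewrite divr_gt0//; lra.
have etaL : eta * (L + 1) = e by rewrite /eta divfK//; lra.
pose d' := (delta^-1 + eta)^-1.
have dV0 : 0 < delta^-1 by rewrite invr_gt0.
have d'P : 0 < d' < delta.
  rewrite /d' invr_gt0 addr_gt0//= -[ltRHS]invrK ltf_pV2 ?posrE ?addr_gt0//.
  by rewrite ltrDl.
have HeE : delta^-1 * He th = rhob * a + (delta^-1 - rhob) * L.
  by rewrite /He /a /L /th; field; lra.
have := near_dimension d'P d1 cvg.
rewrite {2}/d' invrK => dim.
near=> n.
have [np le_p] : (n <= p n)%N /\ ((p n)%:R : R) <= n%:R * (delta^-1 + eta).
  by near: n; exact: dim.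
have Ln : L / eta <= n%:R by near: n; exact: nbhs_infty_ger.
have rn : rhob^-1 <= n%:R by near: n; exact: nbhs_infty_ger.
set r := Num.truncn _.
have n0 : 0 <= (n%:R : R) by [].
have [rle rge] : (r%:R : R) <= rhob * n%:R /\ rhob * n%:R <= r%:R + 1.
  have /truncn_itv : 0 <= rhob * n%:R by rewrite mulr_ge0// ltW.
  by rewrite -natr1 => /andP[rle rge]; split=> //; exact: ltW.
have rp : (r <= p n)%N.
  rewrite (leq_trans _ np)// -(ler_nat R) (le_trans rle)//.
  by rewrite ler_piMl// ltW.
split.
  by rewrite rp andbT truncn_gt0 -ler_pdivrMl// mulr1.
rewrite (le_trans (@bin_le_expR (p n) r th _ rp)) ?th0//.
rewrite ler_expR HeE -etaL.
have -> : - (r%:R * ln th) - ((p n)%:R - r%:R) * ln (1 - th) =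
    r%:R * a + ((p n)%:R - r%:R) * L by rewrite /a /L; ring.
have ra : r%:R * a <= rhob * n%:R * a by rewrite ler_wpM2r.
have prL : ((p n)%:R - r%:R) * L <=
    (n%:R * (delta^-1 + eta) - rhob * n%:R + 1) * L.
  by rewrite ler_wpM2r//; lra.
have Leta : L <= n%:R * eta by rewrite -ler_pdivrMr.
by lra.
Unshelve. all: by end_near. Qed.

End EntropyBound.

Section UnionBound.
Context {R : realType}.

Lemma law_deviates_columns (X : forall n r : nat, random_matrix R n r)
    n p (M : random_matrix R n p) (a t : R) (J : {set 'I_p}) :
  singular_value_model X M -> (0 < #|J|)%N ->
  #|J|%:Z <= Num.ceil (2 * rho0 R * n%:R) ->
  law M [set A | deviates a t (columns J A)] = law (X n #|J|) (deviates a t).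
Proof.
by move=> svm J0 Jle; apply: svm => //; exact: mx_measurable_deviates.
Qed.

(** Union bound over the ['C(p, r)] possible sets of columns, each of which
    contributes the same probability since only the law of [M_J] matters. *)
Lemma law_le_of_deviates (X : forall n r : nat, random_matrix R n r)
    n p r (M : random_matrix R n p) (a t q : R) (E : set 'M[R]_(n, p)) :
  singular_value_model X M -> (0 < r <= p)%N ->
  r%:Z <= Num.ceil (2 * rho0 R * n%:R) ->
  (law (X n r) (deviates a t) <= q%:E)%E ->
  measurable (mx_fun M @^-1` E) ->
  (forall A, E A ->
     exists2 J : {set 'I_p}, #|J| = r & deviates a t (columns J A)) ->
  (law M E <= ('C(p, r)%:R * q)%:E)%E.
Proof.
move=> svm /andP[r0 rp] rle lawq mE devE.
pose F (J : {set 'I_p}) := mx_fun M @^-1` [set A | deviates a t (columns J A)].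
have mF (J : {set 'I_p}) : #|J| = r -> measurable (F J).
  move=> Jr; have J0 : (0 < #|J|)%N by rewrite Jr.
  apply: measurable_deviates_columns J0.
  exact: mx_entry_measurable.
have leF (J : {set 'I_p}) : #|J| = r -> (mx_prob M (F J) <= q%:E)%E.
  move=> Jr; rewrite -[mx_prob M _]/(law M _).
  rewrite (law_deviates_columns a t svm) ?Jr//.
pose S : seq {set 'I_p} := enum [set J : {set 'I_p} | #|J| == r]%SET.
pose SJ k := nth finset.set0 S k.
have inS k : (k < size S)%N -> #|SJ k| = r.
  move=> kS; apply/eqP; have := mem_nth finset.set0 kS.
  by rewrite mem_enum inE.
have sizeS : size S = 'C(p, r) by rewrite -cardE card_draws card_ord.
have mFk k : `I_(size S) k -> measurable (F (SJ k)) by move=> /inS; exact: mF.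
have subF : mx_fun M @^-1` E `<=` \big[setU/set0]_(k < size S) F (SJ k).
  move=> w /devE[J Jr devJ].
  rewrite -(bigcup_mkord (size S) (fun k => F (SJ k))).
  have JS : J \in S by rewrite mem_enum inE Jr.
  by exists (index J S); rewrite /= ?index_mem// /SJ nth_index.
rewrite /law (le_trans (content_subadditive (mx_prob M) mFk mE subF))//.
rewrite (@le_trans _ _ (\sum_(k < size S) q%:E)%E)//.
  by apply: lee_sum => k _; exact/leF/inS.
by rewrite sumEFin lee_fin sumr_const card_ord sizeS mulr_natl.
Qed.

(** The exponential rate [W] beats the entropy [He (rhob * delta) / delta] of
    the choice of the columns, and half of the gap is left as a rate. *)
Lemma near_law_le_of_deviates (X : forall n r : nat, random_matrix R n r)
    (rhob delta c W t : R) (p : nat -> nat)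
    (M : forall n, random_matrix R n (p n)) (n0 : nat) :
  0 < rhob < 2 * rho0 R -> 2 * rho0 R < 1 -> 0 < delta < 1 -> 0 <= c ->
  delta^-1 * He (rhob * delta) < W ->
  (forall n, (n0 <= n)%N -> (0 < Num.truncn (rhob * n%:R))%N ->
     (law (X n (Num.truncn (rhob * n%:R))) (deviates (Num.sqrt rhob) t)
      <= (c * expR (- (n%:R * W)))%:E)%E) ->
  (n%:R / (p n)%:R : R) @[n --> \oo] --> delta ->
  (forall n, (2 <= n)%N -> singular_value_model X (M n)) ->
  \forall n \near \oo,
    (0 < Num.truncn (rhob * n%:R) <= p n)%N /\
    forall E : set 'M[R]_(n, p n), measurable (mx_fun (M n) @^-1` E) ->
      (forall A, E A -> exists2 J : {set 'I_(p n)},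
         #|J| = Num.truncn (rhob * n%:R) &
         deviates (Num.sqrt rhob) t (columns J A)) ->
      (law (M n) E <=
       (c * expR (- (n%:R * ((W - delta^-1 * He (rhob * delta)) / 2))))%:E)%E.
Proof.
move=> /andP[r0 r2] rho1 d01 c0 HW dev cvg svm.
set H := delta^-1 * _ in HW *.
have r01 : 0 < rhob < 1 by rewrite r0 (lt_trans r2).
have gap : 0 < (W - H) / 2 by lra.
have bin := near_binomial_le d01 r01 gap cvg.
near=> n.
have [rp binle] : (0 < Num.truncn (rhob * n%:R) <= p n)%N /\
    'C(p n, Num.truncn (rhob * n%:R))%:R <= expR (n%:R * (H + (W - H) / 2)).
  by near: n; exact: bin.
split=> // E mE devE.
have n2 : (2 <= n)%N by near: n; exact: nbhs_infty_ge.
have n0n : (n0 <= n)%N by near: n; exact: nbhs_infty_ge.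
have rceil : (Num.truncn (rhob * n%:R))%:Z <= Num.ceil (2 * rho0 R * n%:R).
  have rle : (Num.truncn (rhob * n%:R))%:R <= 2 * rho0 R * n%:R.
    apply: (@le_trans _ _ (rhob * n%:R)).
      by rewrite truncn_le mulr_ge0// ltW.
    by rewrite ler_wpM2r// ltW.
  rewrite -(ler_int R) (le_trans rle)//; exact: ceil_ge.
have [r_gt0 _] := andP rp.
have := law_le_of_deviates (svm n n2) rp rceil (dev n n0n r_gt0) mE devE.
move=> /le_trans; apply; rewrite lee_fin.
rewrite mulrCA ler_wpM2l//.
apply: (le_trans (ler_wpM2r (expR_ge0 _) binle)).
rewrite -expRD ler_expR; lra.
Unshelve. all: by end_near. Qed.

End UnionBound.

(** * Constants and rates *)

Section Constants.
Context {R : realType}.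

Lemma sqrt41_bounds : 6 < (Num.sqrt 41 : R) < 7.
Proof.
have s0 : 0 <= Num.sqrt 41 :> R by exact: sqrtr_ge0.
have s2 : Num.sqrt 41 ^+ 2 = 41 :> R by rewrite sqr_sqrtr.
by apply/andP; split; nra.
Qed.

Lemma sqrt_2rho0 : Num.sqrt (2 * rho0 R) = (Num.sqrt 41 - 5) / 4.
Proof.
have /andP[lo _] := sqrt41_bounds.
have s2 : Num.sqrt 41 ^+ 2 = 41 :> R by rewrite sqr_sqrtr.
have -> : 2 * rho0 R = ((Num.sqrt 41 - 5) / 4) ^+ 2.
  by rewrite /rho0; move: s2; set s := Num.sqrt 41 => s2; lra.
by rewrite sqrtr_sqr ger0_norm//; lra.
Qed.

Lemma sqrt_2rho0_bounds : 0 < Num.sqrt (2 * rho0 R) < 1 / 2.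
Proof.
rewrite sqrt_2rho0; have /andP[lo hi] := sqrt41_bounds; apply/andP; lra.
Qed.

Lemma rho0_bounds : 0 < 2 * rho0 R < 1 / 4.
Proof.
have /andP[S0 S1] := sqrt_2rho0_bounds.
have pos : 0 < 2 * rho0 R by rewrite -sqrtr_gt0.
rewrite pos -(sqr_sqrtr (ltW pos)); nra.
Qed.

(** The critical ratio is the one reached when [sigma_max] is at most
    [1 + sqrt (2 * rho0 R)] and [sigma_min] at least [1 - sqrt (2 * rho0 R)]. *)
Lemma critical_ratio : let S := Num.sqrt (2 * rho0 R) in
  (1 + S) ^+ 2 = (4 + Num.sqrt 41) ^+ 2 / 25 * (1 - S) ^+ 2.
Proof.
rewrite /= sqrt_2rho0.
have s2 : Num.sqrt 41 ^+ 2 = 41 :> R by rewrite sqr_sqrtr.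
move: s2; set s := Num.sqrt 41 => s2.
(* 5 (1 + S) = (4 + s) (1 - S) because s * s = 41 *)
have -> : 1 + (s - 5) / 4 = (4 + s) / 5 * (1 - (s - 5) / 4) by lra.
by rewrite exprMn; congr (_ * _); field.
Qed.

Lemma He_le (th : R) : 0 < th < 1 -> He th <= th * (1 - ln th).
Proof.
move=> /andP[th0 th1]; rewrite /He.
have u0 : 0 < 1 - th by lra.
have : - ln (1 - th) <= th / (1 - th).
  rewrite -lnV ?posrE//.
  have -> : ln (1 - th)^-1 = ln (1 + th / (1 - th)) by congr ln; field; lra.
  by rewrite le_ln1Dx// (lt_trans _ (divr_gt0 th0 u0)).
rewrite ler_pdivlMr// => le_th.
by lra.
Qed.

(** The lower bound on [delta] is the inequality [delta^-1 * He theta < w] with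
    [theta = 2 * rho * delta] and [He theta] replaced by the upper bound of
    [He_le], solved for [delta]. *)
Lemma entropy_lt_rate (delta rho w : R) : 0 < delta < 1 -> 0 < 2 * rho < 1 ->
  (2 * rho)^-1 * expR (1 - (2 * rho)^-1 * w) < delta ->
  delta^-1 * He (2 * rho * delta) < w.
Proof.
move=> /andP[d0 d1] /andP[r0 r1] lt_delta.
have th0 : 0 < 2 * rho * delta by rewrite mulr_gt0.
have th1 : 2 * rho * delta < 1 by rewrite (lt_trans _ d1)// gtr_pMl.
have /He_le He_th : 0 < 2 * rho * delta < 1 by rewrite th0.
apply: (@le_lt_trans _ _ (2 * rho * (1 - ln (2 * rho * delta)))).
  by rewrite ler_pdivrMl// (le_trans He_th)//; lra.
have : 1 - (2 * rho)^-1 * w < ln (2 * rho * delta).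
  by rewrite -(@expRK R (1 - _)) ltr_ln ?posrE ?expR_gt0// -ltr_pdivrMl.
rewrite ltrBlDr -ltrBlDl -(ltr_pM2l r0) mulVKf ?gt_eqF//.
Qed.

End Constants.

Section Rates.
Context {R : realType}.

Lemma expR_rate_cvg0 (D : R) : 0 < D -> expR (- (n%:R * D)) @[n --> \oo] --> 0.
Proof.
move=> D0; under eq_fun do rewrite -mulrN expRM_natl.
by apply: cvg_expr; rewrite ger0_norm ?expR_ge0// expR_lt1; lra.
Qed.

Lemma continuous_left_gt (W : R -> R) (S T y : R) : 0 < T < S ->
  {within `[0, S[, continuous W} -> y < W T ->
  exists2 t, 0 < t < T & y < W t.
Proof.
move=> /andP[T0 TS] contW ltWT.
have contT : {for T, continuous W}.
  have : {within `]0, S[, continuous W}.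
    by apply: continuous_subspaceW contW; apply: subset_itv_oo_co.
  rewrite continuous_open_subspace; last exact: interval_open.
  by apply; rewrite inE/= in_itv/= T0.
have /nbhs_ballP : \forall x \near T, y < W x by exact: cvgr_gt contT _ ltWT.
move=> [e /= e0 ball_e].
exists (T - Num.min (e / 2) (T / 2)).
  have m0 : 0 < Num.min (e / 2) (T / 2) by rewrite lt_min; apply/andP; lra.
  have mT : Num.min (e / 2) (T / 2) <= T / 2 by rewrite ge_min lexx orbT.
  by apply/andP; lra.
apply: ball_e; rewrite /ball/= opprB addrC subrK gtr0_norm.
  by rewrite gt_min; apply/orP; left; lra.
by rewrite lt_min; apply/andP; lra.
Qed.

End Rates.

(** * Failure of the restricted isometry bounds *)

Section FailureEvents.
Context {R : realType}.

(** The cost in the bounds on the restricted isometry constants of replacing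
    [t] by [t + eta], with [x = a + t]; the second difference is
    [eta * (2 + 2 * x + eta)], at most [4 * eta]. *)
Lemma frame_slack (x eta eps : R) :
  0 < eps -> 0 <= eta -> eta <= eps / 6 -> 0 <= x <= 1 - eta ->
  1 - (1 - (x + eta)) ^+ 2 < x * (2 - x) + eps /\
  (1 + (x + eta)) ^+ 2 - 1 < x * (2 + x) + eps.
Proof.
move=> eps0 eta0 eta_eps /andP[x0 x1].
have xe0 : 0 <= eta * x by rewrite mulr_ge0.
have xe1 : eta * x <= eta * (1 - eta) by rewrite ler_wpM2l.
have ee0 : 0 <= eta * eta by rewrite mulr_ge0.
by split; lra.
Qed.

Lemma exists_deviates a t n p r s (A : 'M[R]_(n, p)) :
  (0 < r)%N -> (s <= r <= p)%N -> 0 <= a + t <= 1 ->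
  1 - (1 - (a + t)) ^+ 2 < ric_min s A \/
    (1 + (a + t)) ^+ 2 - 1 < ric_max s A ->
  exists2 J : {set 'I_p}, #|J| = r & deviates a t (columns J A).
Proof.
move=> r0 sr at01 large; apply: contrapT => nodev.
have [J Jr devJ|lemin lemax] := ric_le_of_not_deviates r0 sr at01 (A := A).
  by apply: nodev; exists J.
by case: large; rewrite ltNge => /negP.
Qed.

Lemma measurable_ric_ratio_all_lt d (T : measurableType d) n p (D : set nat) K
    (f : T -> 'M[R]_(n, p)) : entries_measurable f ->
  measurable [set w | forall s, D s -> (ric_ratio (2 * s) (f w) < K%:E)%E].
Proof.
move=> mf.
rewrite [X in measurable X](_ : _ =
    \bigcap_(s in D) [set w | (ric_ratio (2 * s) (f w) < K%:E)%E])//.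
by apply: bigcap_measurableType => s _; exact: measurable_ric_ratio_lt.
Qed.

Lemma measurable_ric_min_ge d (T : measurableType d) n p s K
    (f : T -> 'M[R]_(n, p)) : entries_measurable f ->
  measurable [set w | K <= ric_min s (f w)].
Proof.
move=> /(measurable_ric_min s) /(_ measurableT `[K, +oo[%classic).
move=> /(_ (measurable_itv _)); rewrite setTI; congr measurable.
by apply/seteqP; split=> w; rewrite /= in_itv/= andbT.
Qed.

Lemma measurable_ric_max_ge d (T : measurableType d) n p s K
    (f : T -> 'M[R]_(n, p)) : entries_measurable f ->
  measurable [set w | K <= ric_max s (f w)].
Proof.
move=> /(measurable_ric_max s) /(_ measurableT `[K, +oo[%classic).
move=> /(_ (measurable_itv _)); rewrite setTI; congr measurable.
by apply/seteqP; split=> w; rewrite /= in_itv/= andbT.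
Qed.

End FailureEvents.

Theorem theorem3 (R : realType)
    (X : forall n r : nat, random_matrix R n r)
    (n0 : R -> nat) (c : R -> R) (W : R -> R -> R)
    (n0_ge2 : forall rhob : R, 0 < rhob < 2 * rho0 R -> (2 <= n0 rhob)%N)
    (c_gt0 : forall rhob : R, 0 < rhob < 2 * rho0 R -> 0 < c rhob)
    (W_continuous : forall rhob : R, 0 < rhob < 2 * rho0 R ->
       {within `[0, Num.sqrt (2 * rho0 R)[, continuous (W rhob)})
    (W_increasing : forall rhob : R, 0 < rhob < 2 * rho0 R ->
       {in `[0, Num.sqrt (2 * rho0 R)[ &, {homo W rhob : t u / t < u}})
    (W_at0 : forall rhob : R, 0 < rhob < 2 * rho0 R -> W rhob 0 = 0)
    (deviation : forall rhob : R, 0 < rhob < 2 * rho0 R ->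
       forall n : nat, (n0 rhob <= n)%N ->
       let r := Num.truncn (rhob * n%:R) in
       (0 < r)%N ->
       forall t : R, 0 < t < Num.sqrt (2 * rho0 R) ->
       (law (X n r)
          [set A | (t <= Num.max (sigma_max A - (1 + Num.sqrt rhob))
                                 ((1 - Num.sqrt rhob) - sigma_min A))%R]
        <= (c rhob * expR (- (n%:R * W rhob t)))%:E)%E) :
  (forall delta rho : R, 0 < delta < 1 -> 0 < rho < rho0 R ->
     delta > (2 * rho)^-1 *
       expR (1 - (2 * rho)^-1 *
         W (2 * rho) (Num.sqrt (2 * rho0 R) - Num.sqrt (2 * rho))) ->
     exists D1 : R, 0 < D1 /\
     forall (p : nat -> nat) (M : forall n : nat, random_matrix R n (p n)),
       (n%:R / (p n)%:R : R) @[n --> \oo] --> delta ->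
       (forall n : nat, (2 <= n)%N -> singular_value_model X (M n)) ->
       let good n : set 'M[R]_(n, p n) :=
         [set A | forall s : nat,
            (1 <= s <= Num.truncn (rho * n%:R))%N ->
            (ric_ratio (2 * s) A < ((4 + Num.sqrt 41) ^+ 2 / 25)%:E)%E] in
       (\forall n \near \oo,
          ((1 - 2 * c (2 * rho) * expR (- (n%:R * D1)))%:E
           <= law (M n) (good n))%E) /\
       law (M n) (good n) @[n --> \oo] --> 1%E)
  /\
  (forall eps rhob delta : R, 0 < eps -> 0 < rhob < 2 * rho0 R ->
     0 < delta < 1 ->
     (W rhob @` `[0, Num.sqrt (2 * rho0 R)[) (delta^-1 * He (rhob * delta)) ->
     let t0 := 'pinv_(fun=> 0) `[0, Num.sqrt (2 * rho0 R)[ (W rhob)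
                 (delta^-1 * He (rhob * delta)) in
     exists D2 : R, 0 < D2 /\
     forall (p : nat -> nat) (M : forall n : nat, random_matrix R n (p n)),
       (n%:R / (p n)%:R : R) @[n --> \oo] --> delta ->
       (forall n : nat, (2 <= n)%N -> singular_value_model X (M n)) ->
       \forall n \near \oo,
         (law (M n)
            [set A | (Num.min 1 ((Num.sqrt rhob + t0)
                                 * (2 - Num.sqrt rhob - t0)) + eps
                      <= ric_min (Num.truncn (rhob * n%:R)) A)%R]
          <= (c rhob * expR (- (n%:R * D2)))%:E)%E /\
         (law (M n)
            [set A | ((Num.sqrt rhob + t0) * (2 + Num.sqrt rhob + t0) + eps
                      <= ric_max (Num.truncn (rhob * n%:R)) A)%R]
          <= (c rhob * expR (- (n%:R * D2)))%:E)%E).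
Proof.
have [S0 S12] := andP (@sqrt_2rho0_bounds R).
have [rho0_gt0 rho0_lt] := andP (@rho0_bounds R).
have rho0_lt1 : 2 * rho0 R < 1 by lra.
have sqrt_rhob rhob : 0 < rhob < 2 * rho0 R ->
    0 < Num.sqrt rhob < Num.sqrt (2 * rho0 R).
  move=> /andP[r0 r2]; rewrite sqrtr_gt0 r0/= ltr_sqrt//.
have entM n p (N : random_matrix R n p) : entries_measurable (mx_fun N).
  exact: mx_entry_measurable.
split.
  move=> delta rho d01 /andP[r0 r1] lt_delta.
  pose K := (4 + Num.sqrt 41) ^+ 2 / 25 : R.
  have r02 : 0 < 2 * rho < 2 * rho0 R by apply/andP; lra.
  have [a0 aS] := andP (sqrt_rhob _ r02).
  set S := Num.sqrt (2 * rho0 R) in S0 S12 aS lt_delta *.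
  set a := Num.sqrt (2 * rho) in a0 aS lt_delta *.
  have r021 : 0 < 2 * rho < 1 by apply/andP; lra.
  have gapT := entropy_lt_rate d01 r021 lt_delta.
  have TS : 0 < S - a < S by apply/andP; lra.
  (* Going strictly below S - a keeps the entropy gap and makes the bound on the
     ratio strict. *)
  have [t /andP[t0 tT] gap] := continuous_left_gt TS (W_continuous _ r02) gapT.
  have tS : 0 < t < S by apply/andP; lra.
  set H := delta^-1 * _ in gap gapT.
  pose D := (W (2 * rho) t - H) / 2.
  have D0 : 0 < D by rewrite /D; lra.
  have c0 := c_gt0 _ r02.
  exists D; split => // p M cvg svm good.
  have dev n : (n0 (2 * rho)%R <= n)%N ->
      (0 < Num.truncn (2 * rho * n%:R))%N ->
      (law (X n (Num.truncn (2 * rho * n%:R))) (deviates a t)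
        <= (c (2 * rho) * expR (- (n%:R * W (2 * rho) t)))%:E)%E.
    by move=> n0n r_gt0; exact: deviation.
  have mgood n : measurable (mx_fun (M n) @^-1` good n).
    exact: (measurable_ric_ratio_all_lt _ K (entM _ _ (M n))).
  have goodE n : law (M n) (good n) = (1 - law (M n) (~` good n))%E.
    rewrite /law -preimage_setC -probability_setC ?setCK//.
    exact: measurableC.
  have near_good : \forall n \near \oo,
      ((1 - 2 * c (2 * rho) * expR (- (n%:R * D)))%:E <= law (M n) (good n))%E.
    have := near_law_le_of_deviates r02 rho0_lt1 d01 (ltW c0) gap dev cvg svm.
    apply: filterS => n [rp lawle].
    have {lawle} := lawle (~` good n); rewrite -{1}preimage_setC => lawle.
    rewrite goodE; apply: (@le_trans _ _
        (1 - (c (2 * rho) * expR (- (n%:R * D)))%:E)%E).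
      rewrite -EFinB lee_fin lerB// -mulrA ler_peMl// ?ler1n//.
      by rewrite mulr_ge0 ?expR_ge0// ltW.
    rewrite leeB//; apply: lawle; first exact: measurableC.
    move=> A badA; apply: contrapT => nodev; apply: badA => s /andP[s1 sle].
    have /andP[r_gt0 r_le] := rp.
    have sr : (2 * s <= Num.truncn (2 * rho * n%:R))%N.
      have rn0 : 0 <= rho * n%:R by rewrite mulr_ge0// ltW.
      move: sle; rewrite !truncn_ge_nat//; last by rewrite -mulrA mulr_ge0.
      by rewrite natrM -mulrA ler_pM2l.
    have srp : (2 * s <= Num.truncn (2 * rho * n%:R) <= p n)%N by rewrite sr.
    have at01 : 0 <= a + t <= 1 by apply/andP; lra.
    have [J Jr devJ|lemin lemax] :=
        ric_le_of_not_deviates r_gt0 srp at01 (A := A).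
      by apply: nodev; exists J.
    apply: (ric_ratio_lt _ lemin lemax); first by lra.
    have ratioE := @critical_ratio R; rewrite /= -/S -/K in ratioE.
    apply: (@lt_trans _ _ ((1 + S) ^+ 2)).
      by rewrite ltr_pXn2r ?nnegrE//; lra.
    rewrite ratioE -/K ltr_pM2l; first by rewrite ltr_pXn2r ?nnegrE//; lra.
    rewrite divr_gt0// exprn_gt0// ltr_wpDr ?sqrtr_ge0//.
  split=> //.
  apply: (@squeeze_cvge _ _ _ _ (fun n =>
    (1 - 2 * c (2 * rho) * expR (- (n%:R * D)))%:E) _ (fun=> 1%E)).
  - apply: filterS near_good => n ->/=.
    by rewrite /law probability_le1.
  - apply: cvg_EFin; first by apply: nearW.
    rewrite -[X in _ --> X]subr0; apply: cvgB; first exact: cvg_cst.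
    rewrite -(mulr0 (2 * c (2 * rho))); apply: cvgM; first exact: cvg_cst.
    exact: expR_rate_cvg0.
  - exact: cvg_cst.
move=> eps rhob delta eps0 r02 d01 Wrange t0.
have [a0 aS] := andP (sqrt_rhob _ r02).
set S := Num.sqrt (2 * rho0 R) in S0 S12 aS t0 Wrange *.
set a := Num.sqrt rhob in a0 aS *.
set H := delta^-1 * _ in t0 Wrange *.
have Wt0 : W rhob t0 = H by apply: pinvK; rewrite inE.
have [t00 t0S] : 0 <= t0 /\ t0 < S.
  have : `[0, S[%classic t0 by apply: funS.
  by rewrite /= in_itv/= => /andP.
(* The first term keeps the loss below eps, the second keeps t0 + eta < S. *)
pose eta := Num.min (eps / 6) ((S - t0) / 2).
have eta0 : 0 < eta by rewrite lt_min; apply/andP; lra.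
have eta_eps : eta <= eps / 6 by rewrite ge_min lexx.
have eta_S : eta <= (S - t0) / 2 by rewrite ge_min lexx orbT.
pose t := t0 + eta.
have tS : 0 < t < S by rewrite /t; apply/andP; lra.
have gap : H < W rhob t.
  have [t_gt0 t_lt] := andP tS.
  rewrite -Wt0; apply: W_increasing => //;
    rewrite ?in_itv/= ?t00 ?(ltW t_gt0)//.
  by rewrite ltrDl.
pose D := (W rhob t - H) / 2.
exists D; split; first by rewrite /D; lra.
move=> p M cvg svm.
have dev n : (n0 rhob <= n)%N -> (0 < Num.truncn (rhob * n%:R))%N ->
    (law (X n (Num.truncn (rhob * n%:R))) (deviates a t)
      <= (c rhob * expR (- (n%:R * W rhob t)))%:E)%E.
  by move=> n0n r_gt0; exact: deviation.
have c0 := ltW (c_gt0 _ r02).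
have := near_law_le_of_deviates r02 rho0_lt1 d01 c0 gap dev cvg svm.
apply: filterS => n [/andP[r_gt0 r_le] lawle].
have at01 : 0 <= a + t <= 1 by rewrite /t; apply/andP; lra.
have [|min_slack max_slack] :=
    frame_slack (x := a + t0) eps0 (ltW eta0) eta_eps.
  by apply/andP; lra.
split; apply: lawle.
- exact: (measurable_ric_min_ge _ _ (entM _ _ (M n))).
- move=> A /= large.
  apply: (@exists_deviates _ _ _ _ _ _ (Num.truncn (rhob * n%:R))) => //.
    by rewrite leqnn.
  left; apply: lt_le_trans large.
  have -> : Num.min 1 ((a + t0) * (2 - a - t0)) = (a + t0) * (2 - a - t0).
    by apply/min_idPr; have := sqr_ge0 (1 - (a + t0)); lra.
  by rewrite /t (addrA a) -(addrA 2) -opprD.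
- exact: (measurable_ric_max_ge _ _ (entM _ _ (M n))).
- move=> A /= large.
  apply: (@exists_deviates _ _ _ _ _ _ (Num.truncn (rhob * n%:R))) => //.
    by rewrite leqnn.
  right; apply: lt_le_trans large.
  by rewrite /t (addrA a) -(addrA 2).
Qed.
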